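(* Let $G$ and $H$ be two disjoint non-complete graphs with $m=|V(G)|$, $n=|V(H)|$ and $2\le m\le n$. Then the visibility polynomial of the join of $G$ and $H$ is $\mathcal{V}(G\vee H)=\sum_{i=0}^{m+n-1} r_i x^i$, where: \begin{itemize} \item if $0\le i\le m$, then $r_i=\binom{m+n}{i}$; \item if $m+1\le i\le n$, then $r_i=\sum_{k=0}^{m-1}\binom{m}{k}\binom{n}{i-k}+c_{i-m}(H)+\Theta_{i-m,2}(H)$; \item if $n+1\le i\le m+n-2$, then $r_i=\sum_{k=i-n+1}^{m-1}\binom{m}{k}\binom{n}{i-k}+c_{i-m}(H)+\Theta_{i-m,2}(H)+c_{i-n}(G)+\Theta_{i-n,2}(G)$; \item if $i=m+n-1$, then $r_i=c_{n-1}(H)+\Theta_{n-1,2}(H)+c_{m-1}(G)+\Theta_{m-1,2}(G)$. \end{itemize}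
   Context: Graphs are finite, simple and undirected. For a graph $G=(V,E)$ and $X\subseteq V$, two vertices $u,v$ are $X$-visible if there is a shortest $(u,v)$-path $P$ in $G$ with $V(P)\cap X\subseteq\{u,v\}$ (so vertices in different components are not $X$-visible). A set $X\subseteq V$ is a mutual-visibility set of $G$ if every pair of vertices in $X$ is $X$-visible (the empty set counts as a mutual-visibility set). The visibility polynomial of $G$ is $\mathcal{V}(G)=\sum_{i\ge 0} r_i x^i$, where $r_i$ is the number of mutual-visibility sets of $G$ of cardinality $i$. For vertex-disjoint graphs $G,H$, the join $G\vee H$ has vertex set $V(G)\cup V(H)$ and edge set $E(G)\cup E(H)\cup\{uv: u\in V(G), v\in V(H)\}$. For $X\subseteq V(G)$, $\mathrm{diam}_G(X)=\max_{u,v\in X} d_G(u,v)$, where $d_G$ is the distance in $G$ (infinite between different components). $\Theta_{k,d}(G)$ is the number of mutual-visibility sets $X$ of $G$ with $|X|=k$ and $\mathrm{diam}_G(X)=d$. $c_k(G)$ is the number of $k$-cliques of $G$, i.e. sets of $k$ pairwise adjacent vertices (single vertices are $1$-cliques). Cases whose range of $i$ is empty are vacuous. *)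

(* Defs.v *)
From HB Require Import structures.
From mathcomp Require Import all_boot all_order all_algebra.
Set Implicit Arguments.
Unset Strict Implicit.
Unset Printing Implicit Defensive.

Record sgraph := SGraph {
  vertex :> finType;
  adj : rel vertex;
  adj_sym : symmetric adj;
  adj_irrefl : irreflexive adj
}.

Definition complete (G : sgraph) : bool :=
  [forall u : G, forall v : G, (u != v) ==> adj u v].

Section Visibility.
Variable G : sgraph.
Implicit Types (u v w : G) (p q : seq G) (X : {set G}).

(* The path u :: p goes from u to v; its length (number of edges) is size p. *)
Definition is_path u v p : bool :=
  [&& path (@adj G) u p, last u p == v & uniq (u :: p)].

(* Since is_path u v p forces size p < #|G|, letting p range over the finite
   type #|G|.-bseq G of sequences of size at most #|G| loses no path. *)
Lemma is_path_size u v p : is_path u v p -> size p < #|G|.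
Proof. by case/and3P=> _ _ /card_uniqP /= <-; apply: max_card. Qed.

Definition shortest_path u v p : bool :=
  is_path u v p &&
  [forall q : #|G|.-bseq G, is_path u v q ==> (size p <= size q)].

Lemma shortest_pathP u v p :
  reflect (is_path u v p /\ forall q, is_path u v q -> size p <= size q)
          (shortest_path u v p).
Proof.
apply: (iffP andP) => -[uvp min_p]; split=> //.
  move=> q uvq; have le_q := ltnW (is_path_size uvq).
  by have /implyP/(_ uvq) := forallP min_p (Bseq le_q).
by apply/forallP=> q; apply/implyP; apply: min_p.
Qed.

(* None stands for an infinite distance. *)
Definition dist u v : option nat :=
  omap (fun p : #|G|.-bseq G => size p)
       [pick p : #|G|.-bseq G | shortest_path u v p].

(* None stands for an infinite diameter; diam set0 = Some 0 by convention. *)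
Definition diam X : option nat :=
  if [forall u in X, forall v in X, dist u v != None]
  then Some (\max_(u in X) \max_(v in X) odflt 0 (dist u v))
  else None.

Definition visible X u v : bool :=
  [exists p : #|G|.-bseq G, shortest_path u v p &&
     ([set w in u :: p] :&: X \subset [set u; v])].

Definition mutual_visibility X : bool :=
  [forall u in X, forall v in X, visible X u v].

Definition clique X : bool :=
  [forall u in X, forall v in X, (u != v) ==> adj u v].

End Visibility.

Definition num_mutual_visibility (G : sgraph) (i : nat) : nat :=
  #|[set X : {set G} | mutual_visibility X && (#|X| == i)]|.

Definition visibility_poly (G : sgraph) : {poly int} :=
  (\sum_(0 <= i < #|G|.+1) (num_mutual_visibility G i)%:Z *: 'X^i)%R.

Definition Theta (k d : nat) (G : sgraph) : nat :=
  #|[set X : {set G} |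
      [&& mutual_visibility X, #|X| == k & diam X == Some d]]|.

Definition num_cliques (k : nat) (G : sgraph) : nat :=
  #|[set X : {set G} | clique X && (#|X| == k)]|.

Section Join.
Variables G H : sgraph.

Definition join_adj : rel (G + H)%type := fun x y =>
  match x, y with
  | inl u, inl v => adj u v
  | inr u, inr v => adj u v
  | _, _ => true
  end.

Lemma join_adj_sym : symmetric join_adj.
Proof. by case=> u [] v //=; apply: adj_sym. Qed.

Lemma join_adj_irrefl : irreflexive join_adj.
Proof. by case=> u /=; apply: adj_irrefl. Qed.

(* The disjoint union of the vertex sets is the sum type, so that G and H are
   disjoint by construction. *)
Definition join : sgraph := SGraph join_adj_sym join_adj_irrefl.

End Join.

(* Main.v *)
Require Import Defs.
From HB Require Import structures.
From mathcomp Require Import all_boot all_order all_algebra.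
From mathcomp Require Import zify.
Set Implicit Arguments.
Unset Strict Implicit.
Unset Printing Implicit Defensive.

(** A join of two non-complete graphs has diameter 2, so two distinct vertices of
a set X are X-visible exactly when they are adjacent or have a common neighbour
outside X. Call such a pair mediated by X. In an arbitrary graph the
sets whose pairs of distinct vertices are all mediated are the cliques and the
mutual-visibility sets of diameter 2 ([all_mediatedE]); this is where the
numbers c_k and Theta_(k,2) come from.

Write a subset X of the join as the disjoint union of A, a set of vertices of G,
and B, a set of vertices of H. Every vertex of H is a common neighbour of any
two vertices of G, so a pair in A is mediated as soon as B misses a vertex of H;
if B contains all of H, only the vertices of G outside A can mediate it.
Symmetrically for B. Hence X is a mutual-visibility set unless one of the parts
is full and the other one has an unmediated pair
([mutual_visibility_join]). In particular the two parts are not both full, as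
neither graph is complete.

The coefficient r_i is then computed by slicing the i-sets X according to
k = |A|. If neither part is full, every choice of A and B is allowed and the
slice has binom(m,k) binom(n,i-k) elements ([join_slice_binomial]). The slice
k = m counts the sets B of size i-m with all pairs mediated
([join_slice_left]); the slice k = i-n, where B is full, counts such sets A of
size i-n ([join_slice_right]). For i <= m a full part forces the other part to
be empty, so all i-sets count. The same happens in the slice k = 0, i = n, which
is why the binomial formula remains valid there and the sum for m < i <= n runs
over all k < m. For i > n the full slices k = i-n and k = m are separated from
the sum; for i = m+n-1 they are consecutive and the sum of binomials is
empty. *)

(** * Shortest paths of length at most two *)

Arguments shortest_pathP {G u v p}.

Definition mediated (G : sgraph) (X : {set G}) (u v : G) : bool :=
  adj u v || [exists w, [&& w \notin X, adj u w & adj w v]].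

Definition all_mediated (G : sgraph) (X : {set G}) : bool :=
  [forall u in X, forall v in X, (u != v) ==> mediated X u v].

Lemma all_mediatedP (G : sgraph) (X : {set G}) :
  reflect {in X &, forall u v, u != v -> mediated X u v} (all_mediated X).
Proof.
apply: (iffP forall_inP) => [medX u v uX vX | medX u uX].
  by move: (medX u uX) => /forall_inP/(_ v vX)/implyP.
by apply/forall_inP => v vX; apply/implyP; apply: medX.
Qed.

Arguments all_mediatedP {G X}.

(** A shortest path has fewer than #|G| edges, so the bounded sequences in the
definition of visibility include all shortest paths. *)
Lemma visibleP (G : sgraph) (X : {set G}) (u v : G) :
  reflect (exists2 p : seq G, shortest_path u v p
             & [set w in u :: p] :&: X \subset [set u; v])
          (visible X u v).
Proof.
apply: (iffP existsP) => [[p /andP[sp pX]] | [p sp pX]]; first by exists p.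
have [/is_path_size/ltnW le_p _] := shortest_pathP sp.
by exists (Bseq le_p); apply/andP.
Qed.

Arguments visibleP {G X u v}.

Lemma dist_shortest (G : sgraph) (u v : G) (p : seq G) :
  shortest_path u v p -> dist u v = Some (size p).
Proof.
move=> sp; have [uvp min_p] := shortest_pathP sp.
rewrite /dist; case: pickP => [q sq | noq].
  have [uvq min_q] := shortest_pathP sq.
  by congr Some; apply/eqP; rewrite eqn_leq min_q ?min_p.
by have := noq (Bseq (ltnW (is_path_size uvp))); rewrite /= sp.
Qed.

Lemma shortest_refl (G : sgraph) (u : G) : shortest_path u u [::].
Proof. by apply/shortest_pathP; rewrite /is_path /= eqxx. Qed.

Lemma shortest_adj (G : sgraph) (u v : G) :
  adj u v -> shortest_path u v [:: v].
Proof.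
move=> uv; have u'v : u != v by apply: contraTneq uv => ->; rewrite adj_irrefl.
apply/shortest_pathP; split; first by rewrite /is_path /= uv eqxx inE u'v.
by case=> [|x q] //; rewrite /is_path /= (negPf u'v).
Qed.

Lemma is_path2 (G : sgraph) (u v w : G) :
  u != v -> adj u w -> adj w v -> is_path u v [:: w; v].
Proof.
move=> u'v uw wv; rewrite /is_path /= uw wv eqxx !inE (negPf u'v) orbF andbT /=.
by apply/and3P; split=> //; [apply: contraTneq uw | apply: contraTneq wv] => ->;
  rewrite adj_irrefl.
Qed.

Lemma shortest_path2 (G : sgraph) (u v w : G) :
  u != v -> ~~ adj u v -> adj u w -> adj w v -> shortest_path u v [:: w; v].
Proof.
move=> u'v uv' uw wv; apply/shortest_pathP; split; first exact: is_path2.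
(* A shorter path has length 0 or 1, so its ends are equal or adjacent. *)
case=> [|x [|y q]] //; rewrite /is_path /=; first by rewrite (negPf u'v).
by case/and3P=> /andP[ux _] /eqP xv _; rewrite -xv ux in uv'.
Qed.

(** The converse is [short_visible_mediated], which has to assume that the
shortest path is short: vertices at distance three or more are never mediated,
but they may be visible. *)
Lemma mediated_shortest (G : sgraph) (X : {set G}) (u v : G) :
    u != v -> mediated X u v ->
  exists p, [/\ shortest_path u v p, size p = (~~ adj u v).+1
              & [set w in u :: p] :&: X \subset [set u; v]].
Proof.
move=> u'v; rewrite /mediated; have [uv _ | uv' /=] := boolP (adj u v).
  exists [:: v]; split; rewrite ?shortest_adj //.
  by apply/subsetP=> w; rewrite !inE => /andP[].
case/existsP=> w /and3P[wX uw wv]; exists [:: w; v].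
split=> //; first exact: shortest_path2.
apply/subsetP=> x; rewrite !inE => /andP[/or3P[] /eqP-> xX]; rewrite ?eqxx ?orbT //.
by rewrite xX in wX.
Qed.

Lemma short_visible_mediated (G : sgraph) (X : {set G}) (u v : G) (p : seq G) :
    u != v -> shortest_path u v p -> size p <= 2 ->
    [set w in u :: p] :&: X \subset [set u; v] ->
  mediated X u v.
Proof.
move=> u'v /shortest_pathP[/and3P[]]; rewrite /mediated.
case: p => [|x [|y []]] //=; first by rewrite (negPf u'v).
  by case/andP=> ux _ /eqP <-; rewrite ux.
case/and3P=> ux xy _ /eqP <-; rewrite !inE => /and3P[] /norP[u'x _] x'y _ _ _ pX.
apply/orP; right; apply/existsP; exists x; rewrite ux xy !andbT.
apply/negP=> xX; have /subsetP/(_ x) := pX.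
by rewrite !inE eqxx orbT xX eq_sym (negPf u'x) (negPf x'y) => /(_ isT).
Qed.

Lemma all_mediated_mutual_visibility (G : sgraph) (X : {set G}) :
  all_mediated X -> mutual_visibility X.
Proof.
move/all_mediatedP=> medX; apply/forall_inP=> u uX; apply/forall_inP=> v vX.
apply/visibleP; have [<-|u'v] := eqVneq u v.
  exists [::]; first exact: shortest_refl.
  by apply/subsetP=> w; rewrite !inE => /andP[->].
by have [p [sp _ pX]] := mediated_shortest u'v (medX u v uX vX u'v); exists p.
Qed.

(** * Mediated sets: cliques and mutual-visibility sets of diameter two *)

Lemma diam_Some (G : sgraph) (X : {set G}) (d : nat) :
    {in X &, forall u v, exists2 e, dist u v = Some e & e <= d} ->
    (exists u v, [/\ u \in X, v \in X & dist u v = Some d]) ->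
  diam X = Some d.
Proof.
move=> le_d [u [v [uX vX uv_d]]]; rewrite /diam ifT; last first.
  apply/forall_inP=> x xX; apply/forall_inP=> y yX.
  by have [e ->] := le_d x y xX yX.
congr Some; apply/eqP; rewrite eqn_leq; apply/andP; split.
  apply/bigmax_leqP=> x xX; apply/bigmax_leqP=> y yX.
  by have [e ->] := le_d x y xX yX.
by apply: (bigmax_sup u) => //; apply: (bigmax_sup v) => //; rewrite uv_d.
Qed.

Lemma dist_le_diam (G : sgraph) (X : {set G}) (d : nat) :
    diam X = Some d ->
  {in X &, forall u v, exists2 e, dist u v = Some e & e <= d}.
Proof.
rewrite /diam; case: ifP => // /forall_inP fin [<-] u v uX vX.
have /forall_inP/(_ v vX) := fin u uX.
case uv_e: (dist u v) => [e|] // _; exists e => //.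
by apply: (bigmax_sup u) => //; apply: (bigmax_sup v) => //; rewrite uv_e.
Qed.

(** Mediation bounds all distances by 2, and then a mediated set is a clique
unless the bound is attained. Conversely, in a mutual-visibility set of diameter
2, the inner vertex of a shortest path that witnesses visibility is the
mediator. *)
Lemma all_mediatedE (G : sgraph) (X : {set G}) :
  all_mediated X = clique X || (mutual_visibility X && (diam X == Some 2)).
Proof.
apply/idP/idP => [medX | /orP[clX | /andP[visX /eqP dX]]]; last 2 first.
- apply/all_mediatedP=> u v uX vX u'v.
  by have /forall_inP/(_ v vX)/implyP/(_ u'v) := forall_inP clX u uX;
    rewrite /mediated => ->.
- apply/all_mediatedP=> u v uX vX u'v.
  have /forall_inP/(_ v vX)/visibleP[p sp pX] := forall_inP visX u uX.
  have [e] := dist_le_diam dX uX vX; rewrite (dist_shortest sp) => -[<-] le2.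
  exact: short_visible_mediated sp le2 pX.
have [//|clX'] /= := boolP (clique X).
rewrite all_mediated_mutual_visibility //=; apply/eqP/diam_Some.
  move=> u v uX vX; have [<-|u'v] := eqVneq u v.
    by exists 0; rewrite // (dist_shortest (shortest_refl u)).
  have [p [sp szp _]] := mediated_shortest u'v (all_mediatedP medX u v uX vX u'v).
  by exists (size p); rewrite ?(dist_shortest sp) // szp; case: adj.
case/forall_inPn: clX' => u uX /forall_inPn[v vX].
rewrite negb_imply => /andP[u'v uv']; exists u, v; split=> //.
have [p [sp szp _]] := mediated_shortest u'v (all_mediatedP medX u v uX vX u'v).
by rewrite (dist_shortest sp) szp uv'.
Qed.

(** Mediation by the empty set says that the graph has diameter at most 2, so
that the paths witnessing visibility have at most one inner vertex. *)
Lemma mutual_visibilityE (G : sgraph) (X : {set G}) :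
    (forall u v : G, u != v -> mediated set0 u v) ->
  mutual_visibility X = all_mediated X.
Proof.
move=> med; apply/idP/idP=> [visX|]; last exact: all_mediated_mutual_visibility.
apply/all_mediatedP=> u v uX vX u'v.
have /forall_inP/(_ v vX)/visibleP[p sp pX] := forall_inP visX u uX.
apply: (short_visible_mediated u'v sp _ pX).
have [q [/dist_shortest uv_q szq _]] := mediated_shortest u'v (med u v u'v).
by move: uv_q; rewrite (dist_shortest sp) => -[->]; rewrite szq; case: adj.
Qed.

(** The two cases of [all_mediatedE] are exclusive, because a clique has
diameter at most 1. *)
Lemma card_all_mediated (k : nat) (G : sgraph) :
  #|[set X : {set G} | all_mediated X & #|X| == k]| = num_cliques k G + Theta k 2 G.
Proof.
rewrite /num_cliques /Theta -cardsUI -[LHS]addn0; congr (_ + _).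
  apply: eq_card => X; rewrite !inE all_mediatedE.
  by case: clique; case: mutual_visibility; case: eqP; case: eqP.
apply/esym/eqP; rewrite cards_eq0; apply/eqP/setP=> X; rewrite !inE.
apply/negP=> /and4P[/andP[clX _] _ _ /eqP dX].
move: dX; rewrite /diam; case: ifP => // _ [] /eqP; rewrite eqn_leq => /andP[_].
rewrite leqNgt ltnS => /negP; apply; apply/bigmax_leqP=> u uX.
apply/bigmax_leqP=> v vX; have [<-|u'v] := eqVneq u v.
  by rewrite (dist_shortest (shortest_refl u)).
have /forall_inP/(_ v vX)/implyP/(_ u'v) uv := forall_inP clX u uX.
by rewrite (dist_shortest (shortest_adj uv)).
Qed.

Lemma all_mediated_set0 (G : sgraph) : all_mediated (set0 : {set G}).
Proof. by apply/all_mediatedP=> u v; rewrite inE. Qed.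

(** There is no vertex left outside the full set to mediate a non-adjacent
pair. *)
Lemma all_mediated_setT (G : sgraph) : all_mediated [set: G] = complete G.
Proof.
apply: eq_forallb => u; rewrite inE /=; apply: eq_forallb => v; rewrite inE /=.
congr (_ ==> _); rewrite /mediated; case: existsP => [[w]|]; rewrite ?orbF //.
by rewrite inE.
Qed.

(** * Mutual visibility in a join *)

Section JoinParts.
Variables G H : sgraph.
Implicit Types (X : {set join G H}).

Definition lpart X : {set G} := [set u | inl u \in X].
Definition rpart X : {set H} := [set v | inr v \in X].

Lemma card_join_set X : #|X| = #|lpart X| + #|rpart X|.
Proof.
rewrite -!sum1_card big_sumType /=.
by congr (_ + _); apply: eq_bigl => u; rewrite inE.
Qed.

Lemma card_parts (P : {set {set G}}) (Q : {set {set H}}) :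
  #|[set X : {set join G H} | lpart X \in P & rpart X \in Q]| = #|P| * #|Q|.
Proof.
rewrite -cardsX.
(* f is the inverse of X |-> (lpart X, rpart X). *)
pose f (Y : {set G} * {set H}) : {set join G H} :=
  [set x : join G H | match x with inl u => u \in Y.1 | inr v => v \in Y.2 end].
have lf Y : lpart (f Y) = Y.1 by apply/setP=> u; rewrite !inE.
have rf Y : rpart (f Y) = Y.2 by apply/setP=> u; rewrite !inE.
have finj : injective f.
  by move=> Y Z eqYZ; rewrite [Y]surjective_pairing [Z]surjective_pairing -!lf -!rf eqYZ.
rewrite -(card_imset _ finj); apply: eq_card => X; rewrite inE.
apply/idP/imsetP=> [PQ | [[A B] /setXP[AP BQ] ->]]; last by rewrite lf rf AP.
exists (lpart X, rpart X); first by apply/setXP/andP.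
by apply/setP=> -[u|v]; rewrite !inE.
Qed.

End JoinParts.

(** A mediator of two vertices of G is either in G, hence a mediator for the
part in G, or any vertex of H at all outside X. *)
Lemma mediated_inl (G H : sgraph) (X : {set join G H}) (u v : G) :
  mediated X (inl u) (inl v) = mediated (lpart X) u v || (rpart X != setT).
Proof.
rewrite /mediated -orbA; congr (_ || _); apply/existsP/orP.
  case=> -[w | w] /and3P[wX uw wv]; last first.
    by right; apply: contraNneq wX => /setP/(_ w); rewrite !inE.
  by left; apply/existsP; exists w; rewrite inE; apply/and3P.
case=> [/existsP[w /and3P[wX uw wv]] | ].
  by exists (inl w); rewrite inE in wX; apply/and3P.
rewrite -subTset => /subsetPn[w _ wX].
by exists (inr w); rewrite inE in wX; apply/and3P.
Qed.

Lemma mediated_inr (G H : sgraph) (X : {set join G H}) (u v : H) :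
  mediated X (inr u) (inr v) = mediated (rpart X) u v || (lpart X != setT).
Proof.
rewrite /mediated -orbA; congr (_ || _); apply/existsP/orP.
  case=> -[w | w] /and3P[wX uw wv].
    by right; apply: contraNneq wX => /setP/(_ w); rewrite !inE.
  by left; apply/existsP; exists w; rewrite inE; apply/and3P.
case=> [/existsP[w /and3P[wX uw wv]] | ].
  by exists (inr w); rewrite inE in wX; apply/and3P.
rewrite -subTset => /subsetPn[w _ wX].
by exists (inl w); rewrite inE in wX; apply/and3P.
Qed.

Lemma all_mediated_join (G H : sgraph) (X : {set join G H}) :
  all_mediated X = ((rpart X == setT) ==> all_mediated (lpart X))
                && ((lpart X == setT) ==> all_mediated (rpart X)).
Proof.
apply/idP/andP => [/all_mediatedP medX | [lX rX]].
  split; apply/implyP=> /eqP full; apply/all_mediatedP=> u v; rewrite !inE => uX vX u'v.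
    by have := medX _ _ uX vX u'v; rewrite mediated_inl full eqxx orbF.
  by have := medX _ _ uX vX u'v; rewrite mediated_inr full eqxx orbF.
apply/all_mediatedP=> -[u|u] [v|v] //= uX vX u'v.
  rewrite mediated_inl; case: eqP lX => [_|]; rewrite ?orbT // => /all_mediatedP.
  by move=> ->; rewrite ?inE.
rewrite mediated_inr; case: eqP rX => [_|]; rewrite ?orbT // => /all_mediatedP.
by move=> ->; rewrite ?inE.
Qed.

(** A non-complete graph has a vertex, and any vertex of one graph is a common
neighbour of all vertices of the other one; hence the join has diameter at
most 2. *)
Lemma mutual_visibility_join (G H : sgraph) (X : {set join G H}) :
    ~~ complete G -> ~~ complete H ->
  mutual_visibility X = ((rpart X == setT) ==> all_mediated (lpart X))
                     && ((lpart X == setT) ==> all_mediated (rpart X)).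
Proof.
move=> /forallPn[g _] /forallPn[h _].
rewrite -all_mediated_join; apply: mutual_visibilityE => -[u|u] [v|v] //= _.
  rewrite mediated_inl orbC -subTset; apply/orP; left.
  by apply/subsetPn; exists h; rewrite !inE.
rewrite mediated_inr orbC -subTset; apply/orP; left.
by apply/subsetPn; exists g; rewrite !inE.
Qed.

(** * Counting by the size of the first part *)

Definition join_slice (G H : sgraph) (i k : nat) : nat :=
  #|[set X : {set join G H} |
      [&& mutual_visibility X, #|X| == i & #|lpart X| == k]]|.

Lemma num_mutual_visibility_join (G H : sgraph) (i : nat) :
  num_mutual_visibility (join G H) i
    = \sum_(0 <= k < #|G|.+1) join_slice G H i k.
Proof.
rewrite /num_mutual_visibility -sum1_card.
(* The size of a part is at most #|G|, so inord does not truncate it. *)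
rewrite (partition_big (fun X => inord #|lpart X| : 'I_(#|G|.+1)) predT) //=.
rewrite big_mkord; apply: eq_bigr => k _.
rewrite sum1_card; apply: eq_card => X; rewrite !inE unfold_in /= !inE -andbA.
by rewrite -val_eqE /= inordK // ltnS max_card.
Qed.

Lemma eq_setT_card (T : finType) (A : {set T}) : (A == setT) = (#|A| == #|T|).
Proof. by rewrite eqEcard subsetT cardsT eqn_leq max_card. Qed.

Section Slices.
Variables G H : sgraph.
Hypotheses (hG : ~~ complete G) (hH : ~~ complete H).

Lemma join_slice_parts (i k : nat) (P : {set {set G}}) (Q : {set {set H}}) :
    (forall X : {set join G H},
       [&& mutual_visibility X, #|X| == i & #|lpart X| == k]
         = (lpart X \in P) && (rpart X \in Q)) ->
  join_slice G H i k = #|P| * #|Q|.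
Proof. by move=> PQ; rewrite -card_parts; apply: eq_card => X; rewrite !inE PQ. Qed.

(** The second part is full only when [k == 0], and then the first part is empty
and has no pair to mediate. *)
Lemma join_slice_binomial (i k : nat) :
    k < #|G| -> k <= i -> (i - k < #|H|) || (k == 0) ->
  join_slice G H i k = 'C(#|G|, k) * 'C(#|H|, i - k).
Proof.
move=> ltkG leki small; rewrite -!card_draws; apply: join_slice_parts => X.
rewrite !inE mutual_visibility_join // !eq_setT_card card_join_set.
have [lk|_] := eqVneq #|lpart X| k; last by rewrite !andbF.
rewrite lk (ltn_eqF ltkG) /= !andbT -[i in LHS](subnKC leki) eqn_add2l.
have [rX|] := eqVneq #|rpart X| (i - k); last by rewrite !andbF.
rewrite andbT rX; case/orP: small => [/ltn_eqF-> // | /eqP k0].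
rewrite (_ : lpart X = set0) ?all_mediated_set0 ?implybT //.
by apply/eqP; rewrite -cards_eq0 lk k0.
Qed.

(** The first part is full and the graph G is not complete, so the second part
must not be full; but a set in H with all pairs mediated never is. *)
Lemma join_slice_left (i : nat) :
    #|G| <= i ->
  join_slice G H i #|G| = num_cliques (i - #|G|) H + Theta (i - #|G|) 2 H.
Proof.
move=> leGi; rewrite -card_all_mediated -[RHS]mul1n -(cards1 [set: G]).
apply: join_slice_parts => X.
rewrite !inE mutual_visibility_join // card_join_set -!eq_setT_card.
have [lT|_] := eqVneq (lpart X) setT; last by rewrite !andbF.
rewrite lT cardsT -[i in LHS](subnKC leGi) eqn_add2l all_mediated_setT (negPf hG) andbT /=.
by have [->|] := eqVneq (rpart X) setT; rewrite // all_mediated_setT (negPf hH).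
Qed.

Lemma join_slice_right (i : nat) :
    #|H| <= i ->
  join_slice G H i (i - #|H|) = num_cliques (i - #|H|) G + Theta (i - #|H|) 2 G.
Proof.
move=> leHi; rewrite -card_all_mediated -[RHS]muln1 -(cards1 [set: H]).
apply: join_slice_parts => X.
rewrite !inE mutual_visibility_join // card_join_set (eq_setT_card (rpart X)).
have [lk|_] := eqVneq #|lpart X| (i - #|H|); last by rewrite !andbF.
rewrite lk -[i in _ + _ == i](subnK leHi) eqn_add2l -eq_setT_card !andbT.
have [->|] := eqVneq (rpart X) setT; last by rewrite !andbF.
rewrite all_mediated_setT (negPf hH) /= !andbT.
by have [->|] := eqVneq (lpart X) setT; rewrite ?andbT // all_mediated_setT (negPf hG).
Qed.

Lemma join_slice_small (i k : nat) : k + #|H| < i -> join_slice G H i k = 0.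
Proof.
move=> lt_i; apply/eqP; rewrite cards_eq0; apply/eqP/setP=> X; rewrite !inE.
apply/negP=> /and3P[_ /eqP Xi /eqP lk]; move: lt_i.
by rewrite -Xi card_join_set lk ltn_add2l ltnNge max_card.
Qed.

(** * The coefficients *)

Lemma num_mutual_visibility_join_small (i : nat) :
    i <= #|G| -> i <= #|H| ->
  num_mutual_visibility (join G H) i = 'C(#|G| + #|H|, i).
Proof.
move=> leiG leiH; rewrite -card_sum -card_draws; apply: eq_card => X.
rewrite !inE mutual_visibility_join // !eq_setT_card andbC.
have [Xi|//] := eqVneq #|X| i.
move: leiG leiH; rewrite -Xi card_join_set => leG leH.
have empty (T : finType) (A : {set T}) a b : b == a -> b + #|A| <= a -> A = set0.
  by move=> /eqP-> le; apply/eqP; rewrite -cards_eq0; lia.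
rewrite /=; apply/andP; split; apply/implyP=> full.
  by rewrite (empty _ (lpart X) _ _ full) ?all_mediated_set0 // addnC.
by rewrite (empty _ (rpart X) _ _ full) ?all_mediated_set0.
Qed.

Lemma num_mutual_visibility_join_mid (i : nat) :
    #|G| < i <= #|H| ->
  num_mutual_visibility (join G H) i
    = \sum_(0 <= k < #|G|) 'C(#|G|, k) * 'C(#|H|, i - k)
      + num_cliques (i - #|G|) H + Theta (i - #|G|) 2 H.
Proof.
case/andP=> ltGi leiH; rewrite num_mutual_visibility_join big_nat_recr //=.
rewrite join_slice_left 1?ltnW // addnA; do 2!congr (_ + _).
apply: eq_big_nat => k /andP[_ ltk]; apply: join_slice_binomial => //.
  exact: leq_trans (ltnW ltk) (ltnW ltGi).
by case: k ltk => [|k] ltk; rewrite ?orbT // orbF; lia.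
Qed.

Lemma num_mutual_visibility_join_large (i : nat) :
    #|G| < i -> #|H| < i < #|G| + #|H| ->
  num_mutual_visibility (join G H) i
    = \sum_(i - #|H| + 1 <= k < #|G|) 'C(#|G|, k) * 'C(#|H|, i - k)
      + num_cliques (i - #|G|) H + Theta (i - #|G|) 2 H
      + num_cliques (i - #|H|) G + Theta (i - #|H|) 2 G.
Proof.
move=> ltGi /andP[ltHi lti]; rewrite num_mutual_visibility_join big_nat_recr //=.
have lo_lt : i - #|H| < #|G| by lia.
rewrite join_slice_left 1?ltnW // (big_cat_nat (leq0n _) (ltnW lo_lt)) /=.
rewrite big_nat big1 => [|k ltk]; last first.
  by apply: join_slice_small; rewrite addnC -ltn_subRL.
rewrite big_ltn // join_slice_right 1?ltnW // add0n.
have -> : \sum_((i - #|H|).+1 <= k < #|G|) join_slice G H i k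
    = \sum_((i - #|H|).+1 <= k < #|G|) 'C(#|G|, k) * 'C(#|H|, i - k).
  apply: eq_big_nat => k /andP[lok ltk]; apply: join_slice_binomial => //.
    exact: leq_trans (ltnW ltk) (ltnW ltGi).
  by move: lok ltk ltGi; rewrite ltn_subLR; lia.
by rewrite addn1 -addnA [LHS]addnC !addnA.
Qed.

(** The whole vertex set leaves no mediator for a non-adjacent pair of G. *)
Lemma num_mutual_visibility_join_full :
  num_mutual_visibility (join G H) (#|G| + #|H|) = 0.
Proof.
apply/eqP; rewrite cards_eq0; apply/eqP/setP=> X; rewrite !inE -card_sum -eq_setT_card.
have [->|_] := eqVneq X setT; last by rewrite andbF.
have lT : lpart [set: join G H] = setT by apply/setP=> u; rewrite !inE.
have rT : rpart [set: join G H] = setT by apply/setP=> v; rewrite !inE.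
by rewrite mutual_visibility_join // lT rT !eqxx /= !all_mediated_setT (negPf hG).
Qed.

End Slices.

Theorem theorem22 (G H : sgraph) (m n : nat)
    (hG : ~~ complete G) (hH : ~~ complete H)
    (hm : m = #|G|) (hn : n = #|H|) (hm2 : 2 <= m) (hmn : m <= n) :
  exists r : nat -> nat,
    [/\ visibility_poly (join G H)
          = (\sum_(0 <= i < m + n) (r i)%:Z *: 'X^i)%R,
        forall i, 0 <= i <= m -> r i = 'C(m + n, i),
        forall i, m + 1 <= i <= n ->
          r i = \sum_(0 <= k < m) 'C(m, k) * 'C(n, i - k)
                + num_cliques (i - m) H + Theta (i - m) 2 H,
        forall i, n + 1 <= i <= m + n - 2 ->
          r i = \sum_(i - n + 1 <= k < m) 'C(m, k) * 'C(n, i - k)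
                + num_cliques (i - m) H + Theta (i - m) 2 H
                + num_cliques (i - n) G + Theta (i - n) 2 G
      & forall i, i = m + n - 1 ->
          r i = num_cliques (n - 1) H + Theta (n - 1) 2 H
                + num_cliques (m - 1) G + Theta (m - 1) 2 G].
Proof.
move: hm2 hmn; rewrite {m}hm {n}hn => m_ge2 le_mn.
exists (num_mutual_visibility (join G H)); split.
- rewrite /visibility_poly card_sum big_nat_recr //=.
  by rewrite num_mutual_visibility_join_full // GRing.scale0r GRing.addr0.
- by move=> i le_im; apply: num_mutual_visibility_join_small => //; lia.
- by move=> i; rewrite addn1; apply: num_mutual_visibility_join_mid.
- by move=> i i_bounds; apply: num_mutual_visibility_join_large => //; lia.
move=> i ->; rewrite num_mutual_visibility_join_large //; [|lia..].
rewrite big_geq; last lia.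
by congr (num_cliques _ H + Theta _ 2 H + num_cliques _ G + Theta _ 2 G); lia.
Qed.
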